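(* Let $a,b,c\in\mathbb{R}$ with $c\neq 0$, and let $(J_n)_{n\ge 0}$ be defined by $J_0=0$, $J_1=1$, $J_2=a$ and $J_{n+3}=aJ_{n+2}+bJ_{n+1}+cJ_n$ for $n\ge 0$. Let $\{x_n,y_n\}_{n\ge -1}$ be a well defined solution of the system $$x_{n+1}=\frac{ay_nx_{n-1}+bx_{n-1}+c}{y_nx_{n-1}},\qquad y_{n+1}=\frac{ax_ny_{n-1}+by_{n-1}+c}{x_ny_{n-1}},\qquad n=0,1,\ldots,$$ where the initial values satisfy $(x_{-1},x_0,y_{-1},y_0)\in(\mathbb{R}\setminus\{0\})^4\setminus F$, with $F$ the forbidden set of the system, given by $$F=\bigcup_{n=0}^{\infty}\left\{(x_{-1},x_0,y_{-1},y_0)\in(\mathbb{R}\setminus\{0\})^4: A_n=0\ \text{or}\ B_n=0\right\},$$ $$A_n=J_{n+1}y_0x_{-1}+(J_{n+2}-aJ_{n+1})x_{-1}+cJ_n,\qquad B_n=J_{n+1}x_0y_{-1}+(J_{n+2}-aJ_{n+1})y_{-1}+cJ_n.$$ Then, for $n=0,1,\ldots$, $$x_{2n+1}=\frac{cJ_{2n+1}+(J_{2n+3}-aJ_{2n+2})x_{-1}+J_{2n+2}x_{-1}y_0}{cJ_{2n}+(J_{2n+2}-aJ_{2n+1})x_{-1}+J_{2n+1}x_{-1}y_0},$$ $$x_{2n+2}=\frac{cJ_{2n+2}+(J_{2n+4}-aJ_{2n+3})y_{-1}+J_{2n+3}x_0y_{-1}}{cJ_{2n+1}+(J_{2n+3}-aJ_{2n+2})y_{-1}+J_{2n+2}x_0y_{-1}},$$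 $$y_{2n+1}=\frac{cJ_{2n+1}+(J_{2n+3}-aJ_{2n+2})y_{-1}+J_{2n+2}x_0y_{-1}}{cJ_{2n}+(J_{2n+2}-aJ_{2n+1})y_{-1}+J_{2n+1}x_0y_{-1}},$$ $$y_{2n+2}=\frac{cJ_{2n+2}+(J_{2n+4}-aJ_{2n+3})x_{-1}+J_{2n+3}x_{-1}y_0}{cJ_{2n+1}+(J_{2n+3}-aJ_{2n+2})x_{-1}+J_{2n+2}x_{-1}y_0}.$$
   Context: All quantities are real. A solution $\{x_n,y_n\}_{n\ge -1}$ of the system is called well defined if $x_ny_n\neq 0$ for all $n=-1,0,1,\ldots$ (so that every step of the recursion makes sense). *)

(* Defs.v *)
From Stdlib Require Export Reals ZArith.

Open Scope R_scope.

Fixpoint J (a b c : R) (n : nat) : R :=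
  match n with
  | O => 0
  | S n2 =>
    match n2 with
    | O => 1
    | S n1 =>
      match n1 with
      | O => a
      | S n0 => a * J a b c n2 + b * J a b c n1 + c * J a b c n0
      end
    end
  end.

(* A sequence indexed by n >= -1 is a function on Z of which only the values
   at n >= -1 are ever constrained or used. *)

Definition is_solution (a b c : R) (x y : Z -> R) : Prop :=
  forall n : Z, (0 <= n)%Z ->
    x (n + 1)%Z =
      (a * y n * x (n - 1)%Z + b * x (n - 1)%Z + c) / (y n * x (n - 1)%Z) /\
    y (n + 1)%Z =
      (a * x n * y (n - 1)%Z + b * y (n - 1)%Z + c) / (x n * y (n - 1)%Z).

Definition well_defined (x y : Z -> R) : Prop :=
  forall n : Z, (-1 <= n)%Z -> x n * y n <> 0.

(* Quadruples of initial values are ordered (x_{-1}, x_0, y_{-1}, y_0). *)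

Definition nonzero_quadruples (v : R * R * R * R) : Prop :=
  let '(xm1, x0, ym1, y0) := v in
  xm1 <> 0 /\ x0 <> 0 /\ ym1 <> 0 /\ y0 <> 0.

Definition A (a b c : R) (v : R * R * R * R) (n : nat) : R :=
  let '(xm1, x0, ym1, y0) := v in
  J a b c (n + 1) * y0 * xm1
  + (J a b c (n + 2) - a * J a b c (n + 1)) * xm1 + c * J a b c n.

Definition B (a b c : R) (v : R * R * R * R) (n : nat) : R :=
  let '(xm1, x0, ym1, y0) := v in
  J a b c (n + 1) * x0 * ym1
  + (J a b c (n + 2) - a * J a b c (n + 1)) * ym1 + c * J a b c n.

Definition forbidden_set (a b c : R) (v : R * R * R * R) : Prop :=
  exists n : nat,
    nonzero_quadruples v /\ (A a b c v n = 0 \/ B a b c v n = 0).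

(* Main.v *)
(* Both equations have the same shape, so each of the interlaced sequences
   x_{-1}, y_0, x_1, y_2, ... and y_{-1}, x_0, y_1, x_2, ... solves the scalar
   recurrence z_{n+2} z_{n+1} z_n = a z_{n+1} z_n + b z_n + c.  The products
   z_0 z_1 ... z_{n+1} then satisfy the same third-order linear recurrence as J,
   and z_{n+2} is the quotient of two consecutive products. *)

Require Import Defs.
From Stdlib Require Import Reals ZArith Lia.

Open Scope R_scope.

(** Closed form of the product [z_0 z_1 ... z_{n+1}] when [p = z_0] and [q = z_1]. Up to the order
    of terms it is [A_n] for [(p, q) = (x_{-1}, y_0)] and [B_n] for [(p, q) = (y_{-1}, x_0)]. *)
Definition linear_sol (a b c p q : R) (n : nat) : R :=
  c * J a b c n + (J a b c (n + 2) - a * J a b c (n + 1)) * p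
  + J a b c (n + 1) * p * q.

Lemma J_rec (a b c : R) (n : nat) :
  J a b c (n + 3) = a * J a b c (n + 2) + b * J a b c (n + 1) + c * J a b c n.
Proof.
  replace (n + 3)%nat with (S (S (S n))) by lia.
  replace (n + 2)%nat with (S (S n)) by lia.
  replace (n + 1)%nat with (S n) by lia.
  reflexivity.
Qed.

(** [linear_sol] combines shifts of [J] with coefficients independent of [n], so it inherits the
    linear recurrence of [J]. *)
Lemma linear_sol_rec (a b c p q : R) (n : nat) :
  linear_sol a b c p q (n + 3) =
  a * linear_sol a b c p q (n + 2) + b * linear_sol a b c p q (n + 1)
  + c * linear_sol a b c p q n.
Proof.
  unfold linear_sol.
  rewrite <- !Nat.add_assoc; simpl Nat.add.
  pose proof (J_rec a b c n) as E3.
  pose proof (J_rec a b c (n + 1)) as E4.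
  pose proof (J_rec a b c (n + 2)) as E5.
  rewrite <- !Nat.add_assoc in E4, E5; simpl Nat.add in E4, E5.
  rewrite E5, E4, E3; ring.
Qed.

Definition scalar_rec (a b c : R) (z : nat -> R) : Prop :=
  forall n, z (n + 2)%nat * (z (n + 1)%nat * z n) =
            a * z (n + 1)%nat * z n + b * z n + c.

(** The recurrence for [D] has order three, so the induction carries two consecutive ratios;
    [D n <> 0] is carried along to allow the later division. *)
Lemma linear_sol_step (a b c : R) (z : nat -> R) (n : nat) :
  (forall k, z k <> 0) -> scalar_rec a b c z ->
  let D := linear_sol a b c (z 0%nat) (z 1%nat) in
  D n <> 0 /\ D (n + 1)%nat = z (n + 2)%nat * D n /\
  D (n + 2)%nat = z (n + 3)%nat * D (n + 1)%nat.
Proof.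
  intros z_neq0 z_rec D.
  induction n as [|n [Dn0 [D1 D2]]].
  - assert (D0 : D 0%nat = z 0%nat * z 1%nat)
      by (unfold D, linear_sol; simpl; ring).
    pose proof (z_rec 0%nat) as E2.
    pose proof (z_rec 1%nat) as E3.
    simpl in E2, E3.
    assert (D1 : D 1%nat = z 2%nat * D 0%nat).
    { rewrite D0, (Rmult_comm (z 0%nat)), E2.
      unfold D, linear_sol; simpl; ring. }
    split; [|split].
    + rewrite D0; apply Rmult_integral_contrapositive_currified; apply z_neq0.
    + exact D1.
    + simpl; rewrite D1, D0.
      transitivity (z 0%nat * (z 3%nat * (z 2%nat * z 1%nat))); [|ring].
      rewrite E3.
      (* The third-order recurrence started one index early: [z 0] stands for the product that [D]
         would give at index -1. *)
      transitivity (a * D 1%nat + b * D 0%nat + c * z 0%nat).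
      * unfold D, linear_sol; simpl; ring.
      * rewrite D1, D0; ring.
  - replace (S n + 1)%nat with (n + 2)%nat by lia.
    replace (S n + 2)%nat with (n + 3)%nat by lia.
    replace (S n + 3)%nat with (n + 4)%nat by lia.
    replace (S n) with (n + 1)%nat by lia.
    split; [|split].
    + rewrite D1; apply Rmult_integral_contrapositive_currified; auto.
    + exact D2.
    + pose proof (z_rec (n + 2)%nat) as E.
      rewrite <- !Nat.add_assoc in E; simpl Nat.add in E.
      unfold D at 1; rewrite linear_sol_rec; fold D.
      rewrite D2, D1.
      (* Both [D (n + 2)] and [D (n + 1)] are now multiples of [D n]; the cofactor of [D n] is the
         right side of the scalar recurrence at [n + 2]. *)
      transitivity (D n * (z (n + 4)%nat * (z (n + 3)%nat * z (n + 2)%nat)));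
        [rewrite E|]; ring.
Qed.

Lemma scalar_solution (a b c : R) (z : nat -> R) (n : nat) :
  (forall k, z k <> 0) -> scalar_rec a b c z ->
  z (n + 2)%nat =
  linear_sol a b c (z 0%nat) (z 1%nat) (n + 1) /
  linear_sol a b c (z 0%nat) (z 1%nat) n.
Proof.
  intros z_neq0 z_rec.
  destruct (linear_sol_step a b c z n z_neq0 z_rec) as [Dn0 [-> _]].
  field; exact Dn0.
Qed.

(** The shift by one lets the sequence [x_{-1}, y_0, x_1, ...] start at 0, so even positions read
    [x] at odd indices. Exchanging [x] and [y] gives the other interlaced sequence. *)
Definition interlace (x y : Z -> R) (n : nat) : R :=
  (if Nat.even n then x else y) (Z.of_nat n - 1)%Z.

Lemma well_defined_neq0 (x y : Z -> R) (n : Z) :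
  well_defined x y -> (-1 <= n)%Z -> x n <> 0 /\ y n <> 0.
Proof.
  intros hwd hn; split; intros E; apply (hwd n hn); rewrite E; ring.
Qed.

Lemma interlace_neq0 (x y : Z -> R) (n : nat) :
  well_defined x y -> interlace x y n <> 0.
Proof.
  intros hwd; unfold interlace.
  destruct (well_defined_neq0 x y (Z.of_nat n - 1) hwd) as [hx hy]; [lia|].
  destruct (Nat.even n); assumption.
Qed.

Lemma interlace_rec (a b c : R) (x y : Z -> R) :
  is_solution a b c x y -> well_defined x y ->
  scalar_rec a b c (interlace x y).
Proof.
  intros hsol hwd n; unfold interlace.
  replace (n + 2)%nat with (S (S n)) by lia.
  replace (n + 1)%nat with (S n) by lia.
  change (Nat.even (S (S n))) with (Nat.even n).
  (* All parities are expressed through that of [n], so one case split selects the equation of the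
     system to use. *)
  rewrite Nat.even_succ, <- Nat.negb_even.
  replace (Z.of_nat (S (S n)) - 1)%Z with (Z.of_nat n + 1)%Z by lia.
  replace (Z.of_nat (S n) - 1)%Z with (Z.of_nat n) by lia.
  destruct (hsol (Z.of_nat n)) as [Ex Ey]; [lia|].
  destruct (well_defined_neq0 x y (Z.of_nat n) hwd) as [hx hy]; [lia|].
  destruct (well_defined_neq0 x y (Z.of_nat n - 1) hwd) as [hx' hy']; [lia|].
  destruct (Nat.even n); simpl; [rewrite Ex | rewrite Ey]; field; auto.
Qed.

Lemma interlace_solution (a b c : R) (x y : Z -> R) (n : nat) :
  is_solution a b c x y -> well_defined x y ->
  interlace x y (n + 2) =
  linear_sol a b c (x (-1)%Z) (y 0%Z) (n + 1) /
  linear_sol a b c (x (-1)%Z) (y 0%Z) n.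
Proof.
  intros hsol hwd.
  exact (scalar_solution a b c (interlace x y) n
    (fun k => interlace_neq0 x y k hwd)
    (interlace_rec a b c x y hsol hwd)).
Qed.

(** Positions [2n + 2] and [2n + 3] of the interlaced sequence hold [x_{2n+1}] and [y_{2n+2}]. *)
Lemma solution_odd_even (a b c : R) (x y : Z -> R) (n : nat) :
  is_solution a b c x y -> well_defined x y ->
  x (2 * Z.of_nat n + 1)%Z =
    linear_sol a b c (x (-1)%Z) (y 0%Z) (2 * n + 1) /
    linear_sol a b c (x (-1)%Z) (y 0%Z) (2 * n) /\
  y (2 * Z.of_nat n + 2)%Z =
    linear_sol a b c (x (-1)%Z) (y 0%Z) (2 * n + 2) /
    linear_sol a b c (x (-1)%Z) (y 0%Z) (2 * n + 1).
Proof.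
  intros hsol hwd; split.
  - rewrite <- (interlace_solution a b c x y (2 * n) hsol hwd).
    unfold interlace; rewrite Nat.even_add, Nat.even_even; simpl Nat.even.
    simpl Bool.eqb; cbv iota; apply f_equal; lia.
  - replace (2 * n + 2)%nat with (2 * n + 1 + 1)%nat by lia.
    rewrite <- (interlace_solution a b c x y (2 * n + 1) hsol hwd).
    unfold interlace; rewrite Nat.even_add, Nat.even_odd; simpl Nat.even.
    simpl Bool.eqb; cbv iota; apply f_equal; lia.
Qed.

Lemma is_solution_swap (a b c : R) (x y : Z -> R) :
  is_solution a b c x y -> is_solution a b c y x.
Proof. intros hsol n hn; destruct (hsol n hn); split; assumption. Qed.

Lemma well_defined_swap (x y : Z -> R) : well_defined x y -> well_defined y x.
Proof. intros hwd n hn; rewrite Rmult_comm; auto. Qed.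

Theorem theorem1 (a b c : R) (hc : c <> 0) (x y : Z -> R)
  (hsol : is_solution a b c x y)
  (hwd : well_defined x y)
  (hnz : nonzero_quadruples (x (-1)%Z, x 0%Z, y (-1)%Z, y 0%Z))
  (hF : ~ forbidden_set a b c (x (-1)%Z, x 0%Z, y (-1)%Z, y 0%Z)) :
  forall n : nat,
    x (2 * Z.of_nat n + 1)%Z =
      (c * J a b c (2 * n + 1)
       + (J a b c (2 * n + 3) - a * J a b c (2 * n + 2)) * x (-1)%Z
       + J a b c (2 * n + 2) * x (-1)%Z * y 0%Z) /
      (c * J a b c (2 * n)
       + (J a b c (2 * n + 2) - a * J a b c (2 * n + 1)) * x (-1)%Z
       + J a b c (2 * n + 1) * x (-1)%Z * y 0%Z) /\
    x (2 * Z.of_nat n + 2)%Z =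
      (c * J a b c (2 * n + 2)
       + (J a b c (2 * n + 4) - a * J a b c (2 * n + 3)) * y (-1)%Z
       + J a b c (2 * n + 3) * x 0%Z * y (-1)%Z) /
      (c * J a b c (2 * n + 1)
       + (J a b c (2 * n + 3) - a * J a b c (2 * n + 2)) * y (-1)%Z
       + J a b c (2 * n + 2) * x 0%Z * y (-1)%Z) /\
    y (2 * Z.of_nat n + 1)%Z =
      (c * J a b c (2 * n + 1)
       + (J a b c (2 * n + 3) - a * J a b c (2 * n + 2)) * y (-1)%Z
       + J a b c (2 * n + 2) * x 0%Z * y (-1)%Z) /
      (c * J a b c (2 * n)
       + (J a b c (2 * n + 2) - a * J a b c (2 * n + 1)) * y (-1)%Z
       + J a b c (2 * n + 1) * x 0%Z * y (-1)%Z) /\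
    y (2 * Z.of_nat n + 2)%Z =
      (c * J a b c (2 * n + 2)
       + (J a b c (2 * n + 4) - a * J a b c (2 * n + 3)) * x (-1)%Z
       + J a b c (2 * n + 3) * x (-1)%Z * y 0%Z) /
      (c * J a b c (2 * n + 1)
       + (J a b c (2 * n + 3) - a * J a b c (2 * n + 2)) * x (-1)%Z
       + J a b c (2 * n + 2) * x (-1)%Z * y 0%Z).
Proof.
  intros n.
  destruct (solution_odd_even a b c x y n hsol hwd) as [Ex1 Ey2].
  (* The system is symmetric in [x] and [y], so the exchanged solution yields the other two
     formulas. *)
  destruct (solution_odd_even a b c y x n (is_solution_swap a b c x y hsol)
    (well_defined_swap x y hwd)) as [Ey1 Ex2].
  rewrite Ex1, Ex2, Ey1, Ey2; unfold linear_sol.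
  rewrite <- !Nat.add_assoc; simpl (_ + _)%nat.
  repeat split; f_equal; ring.
Qed.
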